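(* For every integer $k\ge 4$ there exists a constant $c_k\geq \frac{1}{36(k-1)^2}$ such that for all sufficiently large integers $n$ (how large may depend on $k$), $$f_k(n)\leq e(T_{k-2}(n))-c_k n^2 .$$
   Context: All graphs are finite and simple. A graph is $k$-chromatic if it is properly $k$-colorable but not properly $(k-1)$-colorable. A graph $G$ is $k$-critical if $G$ is $k$-chromatic but every proper subgraph of $G$ is $(k-1)$-colorable. $f_k(n)$ denotes the maximum number of edges in an $n$-vertex $k$-critical graph. $T_r(n)$ denotes the Turán graph, i.e. the $n$-vertex balanced complete $r$-partite graph, and $e(G)$ denotes the number of edges of a graph $G$. *)

(* Defs.v *)
From HB Require Import structures.
From mathcomp Require Import all_boot all_order all_algebra.
From mathcomp Require Import reals.

Set Implicit Arguments.
Unset Strict Implicit.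
Unset Printing Implicit Defensive.

(* A finite simple graph whose vertices are taken from the finite type T, given
   by its vertex set and its set of edges. The vertex set need not be all of T,
   so that a graph and its subgraphs have the same type. *)
Definition simple_graph_axiom (T : finType) (p : {set T} * {set {set T}}) : bool :=
  [forall e in p.2, (e \subset p.1) && (#|e| == 2)].

Record sgraph (T : finType) := SGraph {
  sgval :> {set T} * {set {set T}};
  _ : simple_graph_axiom sgval
}.

HB.instance Definition _ (T : finType) := [isSub for @sgval T].
HB.instance Definition _ (T : finType) := [Finite of sgraph T by <:].

Definition vertices (T : finType) (G : sgraph T) : {set T} := (sgval G).1.
Definition edges (T : finType) (G : sgraph T) : {set {set T}} := (sgval G).2.

Definition adjacent (T : finType) (G : sgraph T) (x y : T) : bool :=
  [set x; y] \in edges G.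

Definition proper_subgraph (T : finType) (H G : sgraph T) : bool :=
  [&& vertices H \subset vertices G, edges H \subset edges G & H != G].

Definition proper_coloring (T : finType) (G : sgraph T) (r : nat)
    (c : {ffun {x : T | x \in vertices G} -> 'I_r}) : bool :=
  [forall x, forall y, adjacent G (val x) (val y) ==> (c x != c y)].

Definition colorable (T : finType) (r : nat) (G : sgraph T) : bool :=
  [exists c : {ffun {x : T | x \in vertices G} -> 'I_r}, proper_coloring c].

Definition chromatic (T : finType) (k : nat) (G : sgraph T) : bool :=
  colorable k G && ~~ colorable k.-1 G.

Definition critical (T : finType) (k : nat) (G : sgraph T) : bool :=
  chromatic k G && [forall H : sgraph T, proper_subgraph H G ==> colorable k.-1 H].

(* Every n-vertex graph is isomorphic to one on 'I_n. The value is 0 if there is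
   no n-vertex k-critical graph; for k >= 4 there is one for every n >= k + 2. *)
Definition max_critical_edges (k n : nat) : nat :=
  \max_(G : sgraph 'I_n | (#|vertices G| == n) && critical k G) #|edges G|.

(* The r parts are the residue classes mod r, whose sizes differ by at most 1. *)
Definition turan_edges (r n : nat) : {set {set 'I_n}} :=
  [set [set p.1; p.2] | p in [set q : 'I_n * 'I_n | q.1 %% r != q.2 %% r]].

Lemma turan_simple (r n : nat) :
  simple_graph_axiom ([set: 'I_n], turan_edges r n).
Proof.
apply/forall_inP => e /imsetP[[x y] xy ->]; rewrite inE /= in xy.
rewrite subsetT cards2; case: (eqVneq x y) xy => // ->.
by rewrite eqxx.
Qed.

Definition turan_graph (r n : nat) : sgraph 'I_n := SGraph (turan_simple r n).

(* Main.v *)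
Require Import Defs.
From HB Require Import structures.
From mathcomp Require Import all_boot all_order all_algebra.
From mathcomp Require Import reals.
From mathcomp Require Import zify ring lra.
Import Order.TTheory GRing.Theory Num.Theory.
Local Open Scope ring_scope.

(** Why a dense critical graph loses a quadratic number of edges.

    Let k = r + 3, let t = r + 1 be the number of parts of the Turan graph, and
    let n be the number of vertices of a k-critical graph G. Deleting an edge xy
    leaves a colouring with r + 2 colours in which x and y have the same colour
    and x sees every other colour ([edge_colouring]).

    The heart of the proof is a bound on codegrees. Let Q be a clique of size r,
    let y be a further vertex and let A be the common neighbourhood of Q and y.
    For x in A, colour G - xy as above. The clique Q uses r colours different
    from the common colour of x and y, so that only one colour c is left for the
    whole of A \ x; and x has a neighbour w of colour c, which therefore has no
    neighbour in A \ x. So A is independent once it has three vertices, and its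
    vertices x have pairwise distinct private neighbours w outside A. A vertex
    z of A is thus adjacent neither to A nor to the private neighbours of the
    others, and has degree at most n - 2|A| + 1 ([codegree_bound]). In a graph
    close to the Turan graph one finds Q and y with A almost a full part, of
    size about n / t, whose vertices have degree about n - n / t; this exceeds
    n - 2n / t, a contradiction.

    To find Q and y in a graph with more than (1 - 1/t - g) n^2 / 2 edges, where
    g = 1 / (17 (t + 1)^2), pass to the vertex set S that maximizes
    2 e(S) - p |S|^2 with p = 1 - 1/t - 1/(8 (t + 1)). It is large, and its
    inner degrees are at least p (|S| - 1/2) ([dense_core]). It contains no
    clique K of size t + 1 ([clique_degree_bound]): a clique with as many
    vertices as there are colours has, for every edge disjoint from it, a member
    that is adjacent to neither end, and this bounds the number of vertices that
    miss only one vertex of K, hence the degree sum of K. Now choose the vertices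
    of Q greedily, each of maximal degree in the common neighbourhood of the
    previous ones. This proves the Turan bound for S with a stability term which
    forces the common neighbourhood B of Q in S to have almost |S| / t vertices
    ([greedy_clique], [core_shape]). As B is independent, its vertices send their
    large degrees out of B, so that on average a vertex y outside B is adjacent
    to most of B, against the codegree bound ([common_nbhd_bound],
    [core_codegree]).

    Since g exceeds 2 / (36 (t + 1)^2), there is room for the terms of lower
    order in the number of edges of the Turan graph. *)

Set Implicit Arguments.
Unset Strict Implicit.
Unset Printing Implicit Defensive.

(** * Colourings of edge-critical graphs *)

Section Colouring.
Local Open Scope nat_scope.
Variables (T : finType) (e : rel T).

Definition nbhd (x : T) : {set T} := [set y | e x y].

Definition common_nbhd (Q : {set T}) : {set T} := [set v | [forall u in Q, e u v]].

Definition clique (Q : {set T}) : Prop :=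
  {in Q &, forall u v, u != v -> e u v}.

(** Edge-criticality in the form in which it is used: a proper colouring of the
    graph minus the edge xy is a colouring in which at most xy is monochromatic. *)
Definition edge_critical (q : nat) : Prop :=
  (forall f : T -> 'I_q, exists u v, e u v /\ f u = f v) /\
  (forall x y, e x y -> exists f : T -> 'I_q,
     forall u v, e u v -> f u = f v -> u \in [set x; y] /\ v \in [set x; y]).

Hypotheses (e_sym : symmetric e) (e_irr : irreflexive e).

Lemma in_nbhd x y : (y \in nbhd x) = e x y. Proof. by rewrite inE. Qed.

Lemma common_nbhdP (Q : {set T}) v : reflect {in Q, forall u, e u v} (v \in common_nbhd Q).
Proof. by rewrite inE; apply: (iffP forall_inP). Qed.

Lemma clique_sub (P Q : {set T}) : P \subset Q -> clique Q -> clique P.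
Proof. by move=> /subsetP PQ cQ u v /PQ uQ /PQ; apply: cQ. Qed.

Lemma cliqueU1 x (Q : {set T}) : clique Q -> x \in common_nbhd Q -> clique (x |: Q).
Proof.
move=> cQ /common_nbhdP xQ u v /setU1P[->|uQ] /setU1P[->|vQ]; rewrite ?eqxx //.
- by move=> _; rewrite e_sym xQ.
- by move=> _; rewrite xQ.
- exact: cQ.
Qed.

Lemma notin_common_nbhd (Q : {set T}) v : v \in Q -> v \notin common_nbhd Q.
Proof. by move=> vQ; apply/negP => /common_nbhdP/(_ v vQ); rewrite e_irr. Qed.

(** If x saw no neighbour of colour c, recolouring x with c would properly colour
    the whole graph. *)
Lemma edge_colouring q x y : edge_critical q -> e x y ->
  exists f : T -> 'I_q,
    [/\ f x = f y,
        forall u v, e u v -> f u = f v -> u \in [set x; y] /\ v \in [set x; y]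
      & forall c, c != f x -> exists2 w, e x w & f w = c].
Proof.
move=> [nocol crit] exy; have [f fP] := crit x y exy; exists f.
(* Some edge is monochromatic, and it can only be xy. *)
have fxy : f x = f y.
  have [u [v [euv fuv]]] := nocol f.
  have [] := fP u v euv fuv.
  move=> /set2P[uE|uE] /set2P[vE|vE]; move: fuv euv; rewrite uE vE ?e_irr //.
split=> // c cfx; case: (boolP [exists w, e x w && (f w == c)]).
  by move=> /existsP[w /andP[exw /eqP fw]]; exists w.
move=> /existsPn noc.
have [u [v [euv]]] := nocol (fun w => if w == x then c else f w).
have nfc w : e x w -> f w != c by move=> exw; move: (noc w); rewrite exw.
case: (eqVneq u x) euv => [-> exv|ux euv].
  case: eqVneq exv => [->|vx exv fv]; first by rewrite e_irr.
  by move: (nfc v exv); rewrite fv eqxx.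
case: (eqVneq v x) euv => [-> |vx] euv fuv.
  by move: (nfc u); rewrite e_sym fuv eqxx => /(_ euv).
have [/set2P[uE|uE] /set2P[vE|vE]] := fP u v euv fuv;
  move: euv ux vx; by rewrite uE vE ?eqxx ?e_irr.
Qed.

(** The clique uses every colour in a colouring of the graph minus xy, so that
    one of its vertices has the common colour of x and y. *)
Lemma clique_nonadjacent_edge q (K : {set T}) x y :
    edge_critical q -> clique K -> #|K| = q -> e x y ->
    x \notin K -> y \notin K ->
  exists2 v, v \in K & ~~ e v x && ~~ e v y.
Proof.
move=> crit cK Kq exy xK yK; have [f [fxy fP _]] := edge_colouring crit exy.
have inj : {in K &, injective f}.
  move=> u v uK vK fuv; case: (eqVneq u v) => // uv.
  have [/set2P[uE|uE] _] := fP u v (cK _ _ uK vK uv) fuv;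
    by move: uK; rewrite uE ?(negPf xK) ?(negPf yK).
have : f x \in f @: K.
  suff -> : f @: K = [set: 'I_q] by rewrite inE.
  apply/eqP; by rewrite eqEcard subsetT cardsT card_ord card_in_imset // Kq /=.
move=> /imsetP[v vK fv]; exists v => //.
have vNxy : v \notin [set x; y].
  by apply/negP => /set2P[vE|vE]; move: vK; rewrite vE ?(negPf xK) ?(negPf yK).
apply/andP; split; apply/negP => ev.
  by have [] := fP v x ev (esym fv); rewrite (negPf vNxy).
by have [] := fP v y ev; rewrite ?(negPf vNxy) // -fv.
Qed.

Section Codegree.
Variables (r : nat) (Q : {set T}) (y : T).
Hypotheses (crit : edge_critical r.+2) (cQ : clique Q) (Qr : #|Q| = r)
  (yQ : y \notin Q).
Let A := common_nbhd (y |: Q).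
Hypothesis A3 : 3 <= #|A|.

(** The clique Q and the vertex y occupy all colours but one, and every vertex
    of A other than x must take the remaining colour. *)
Lemma codegree_colouring x : x \in A ->
  exists f : T -> 'I_r.+2, exists c : 'I_r.+2,
    [/\ {in A :\ x, forall u, f u = c},
        forall u v, e u v -> f u = f v -> u \in [set x; y] /\ v \in [set x; y],
        c != f y & exists2 w, e x w & f w = c].
Proof.
move=> xA; have exy : e x y.
  by rewrite e_sym; move/common_nbhdP: xA; apply; rewrite setU11.
have [f [fxy fP see]] := edge_colouring crit exy.
have xQ : x \notin Q.
  by apply: contraL xA => xQ; apply: notin_common_nbhd; rewrite inE xQ orbT.
have Qxy v : v \in Q -> v \notin [set x; y].
  move=> vQ; apply/negP => /set2P[vE|vE]; move: vQ; rewrite vE.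
    by rewrite (negPf xQ).
  by rewrite (negPf yQ).
have inj : {in Q &, injective f}.
  move=> u v uQ vQ fuv; case: (eqVneq u v) => // uv.
  by have [] := fP u v (cQ uQ vQ uv) fuv; rewrite (negPf (Qxy u uQ)).
have fyQ : f y \notin f @: Q.
  apply/negP => /imsetP[v vQ fv].
  have evx : e v x by move/common_nbhdP: xA; apply; rewrite inE vQ orbT.
  by have [] := fP v x evx; rewrite ?(negPf (Qxy v vQ)) // fxy.
have cardD : #|~: (f y |: f @: Q)| = 1.
  have := cardsC (f y |: f @: Q).
  rewrite cardsU1 fyQ card_in_imset // Qr card_ord; lia.
have /eqP/cards1P[c cE] := cardD.
have avoid u : u \in A :\ x -> f u \in ~: (f y |: f @: Q).
  move=> /setD1P[ux uA]; have uN v : v \in y |: Q -> e v u.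
    by move=> vQ; move/common_nbhdP: uA; apply.
  have uy : u != y.
    by apply: contraTneq uA => ->; apply: notin_common_nbhd; rewrite setU11.
  have uxy : u \notin [set x; y] by rewrite !inE negb_or ux uy.
  rewrite !inE negb_or; apply/andP; split.
    apply/eqP => fuy; have := fP y u (uN y (setU11 _ _)) (esym fuy).
    by rewrite (negPf uxy) => -[].
  apply/negP => /imsetP[v vQ fv].
  have := fP v u (uN v _) (esym fv); rewrite inE vQ orbT => /(_ isT).
  by rewrite (negPf uxy) => -[].
have cy : c != f y.
  have : c \in ~: (f y |: f @: Q) by rewrite cE set11.
  by rewrite !inE negb_or => /andP[].
exists f, c; split => //; last by apply: see; rewrite fxy.
by move=> u /avoid; rewrite cE => /set1P.
Qed.

(** Two vertices of A have the same colour in the colouring obtained from a third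
    vertex of A; this is where three vertices are needed. *)
Lemma codegree_independent : {in A &, forall u v, ~~ e u v}.
Proof.
move=> u v uA vA.
have /subsetPn[x xA xuv] : ~~ (A \subset [set u; v]).
  by apply/negP => /subset_leq_card; rewrite cards2; move: A3; case: (u != v); lia.
have [f [c [fc fP _ _]]] := codegree_colouring xA.
apply/negP => euv.
have ux : u != x by apply: contraNneq xuv => <-; rewrite set21.
have vx : v != x by apply: contraNneq xuv => <-; rewrite set22.
have fuv : f u = f v by rewrite (fc u) ?(fc v) // in_setD1 ?ux ?vx.
have uy : u != y.
  by apply: contraTneq uA => ->; apply: notin_common_nbhd; rewrite setU11.
by have [] := fP u v euv fuv; rewrite !inE (negPf ux) (negPf uy).
Qed.

(** The neighbour of x that has the colour of A \ x. *)
Lemma private_neighbour x : x \in A ->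
  exists2 w, e x w & {in A :\ x, forall u, ~~ e u w}.
Proof.
move=> xA; have [f [c [fc fP cy [w exw fw]]]] := codegree_colouring xA.
exists w => // u uAx; apply/negP => euw.
have wy : w != y by apply: contraNneq cy => <-; rewrite fw.
have wx : w != x by apply: contraTneq exw => ->; rewrite e_irr.
have [] := fP u w euw; first by rewrite fc.
by rewrite !inE (negPf wx) (negPf wy).
Qed.

(** The neighbourhood of z, the set A and the private neighbours of the vertices
    of A \ z are pairwise disjoint. *)
Lemma codegree_bound z : z \in A -> #|nbhd z| + 2 * #|A| <= #|T| + 1.
Proof.
move=> zA; pose w x := odflt x [pick w | e x w & [forall u in A :\ x, ~~ e u w]].
have wP x : x \in A -> e x (w x) /\ {in A :\ x, forall u, ~~ e u (w x)}.
  move=> xA; rewrite /w; case: pickP => [t /andP[ext /forall_inP]|none] //=.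
  have [t ext tP] := private_neighbour xA.
  by move: (none t); rewrite ext /= => /forall_inP[].
have winj : {in A :\ z &, injective w}.
  move=> x1 x2 /setD1P[_ x1A] /setD1P[_ x2A] w12.
  case: (eqVneq x1 x2) => // x12.
  have [e1 _] := wP x1 x1A; have [_ /(_ x1)] := wP x2 x2A.
  by rewrite in_setD1 x12 x1A -w12 e1 => /(_ isT).
have disjA : [disjoint A & w @: (A :\ z)].
  rewrite disjoint_subset; apply/subsetP => u uA; rewrite inE.
  apply/negP => /imsetP[x /setD1P[_ xA] uE].
  by have [+ _] := wP x xA; rewrite -uE (negPf (codegree_independent xA uA)).
have disjN : [disjoint nbhd z & A :|: w @: (A :\ z)].
  rewrite disjoint_subset; apply/subsetP => u; rewrite inE => ezu.
  rewrite inE; apply/negP => /setUP[uA|/imsetP[x /setD1P[xz xA] uE]].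
    by move: ezu; rewrite (negPf (codegree_independent zA uA)).
  have [_ /(_ z)] := wP x xA; rewrite -uE ezu in_setD1 eq_sym xz zA.
  by move=> /(_ isT).
have := max_card (mem (nbhd z :|: (A :|: w @: (A :\ z)))).
rewrite !cardsU !(disjoint_setI0 _) // cards0 !subn0 card_in_imset //.
have := cardsD1 z A; rewrite zA; lia.
Qed.
End Codegree.
End Colouring.

(** * Dense vertex sets and greedy cliques *)

Section Density.
Variables (T : finType) (e : rel T).
Hypotheses (e_sym : symmetric e) (e_irr : irreflexive e).
Notation nbhd := (nbhd e).
Notation common_nbhd := (common_nbhd e).
Notation clique := (clique e).
Notation edge_critical := (edge_critical e).

(** Ordered adjacent pairs: [npairs S S] is twice the number of edges inside S. *)
Definition npairs (A B : {set T}) : nat := \sum_(x in A) #|nbhd x :&: B|.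

Lemma npairs_sym A B : npairs A B = npairs B A.
Proof.
have E X Y : npairs X Y = (\sum_(x in X) \sum_(y in Y) e x y)%N.
  apply: eq_bigr => x _; rewrite -sum1_card big_mkcond [RHS]big_mkcond /=.
  by apply: eq_bigr => y _; rewrite !inE andbC; case: (y \in Y); case: (e x y).
rewrite !E exchange_big; apply: eq_bigr => y _; apply: eq_bigr => x _.
by rewrite e_sym.
Qed.

Lemma npairsDr (A B C : {set T}) : C \subset B -> 
  npairs A B = (npairs A C + npairs A (B :\: C))%N.
Proof.
move=> CB; rewrite -big_split; apply: eq_bigr => x _ /=.
rewrite -(cardsID C (nbhd x :&: B)) -setIA (setIidPr CB) setIDA //.
Qed.

Lemma npairsDl (A B C : {set T}) : C \subset B -> 
  npairs B A = (npairs C A + npairs (B :\: C) A)%N.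
Proof. by move=> CB; rewrite npairs_sym (npairsDr _ CB) !(npairs_sym A). Qed.

Lemma npairs_split (S S1 : {set T}) : S1 \subset S ->
  npairs S S = (npairs S1 S1 + npairs (S :\: S1) S1 + npairs (S :\: S1) S)%N.
Proof.
move=> sS; rewrite (npairsDl S sS) (npairsDr S1 sS).
by rewrite (npairs_sym S1 (S :\: S1)).
Qed.

Lemma npairs_del (S : {set T}) x : x \in S ->
  npairs S S = (npairs (S :\ x) (S :\ x) + 2 * #|nbhd x :&: S|)%N.
Proof.
move=> xS; rewrite (npairs_split (subsetDl S [set x])).
have -> : S :\: (S :\ x) = [set x] by rewrite setDDr setDv set0U (setIidPr _) // sub1set.
rewrite /npairs !big_set1.
have -> : nbhd x :&: (S :\ x) = nbhd x :&: S.
  apply/setP => y; rewrite !inE; case: eqVneq => [->|] //; by rewrite e_irr.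
by rewrite -addnA addnn mul2n.
Qed.

Lemma npairs_le_sqr (S : {set T}) : (npairs S S <= #|S| ^ 2)%N.
Proof.
rewrite /npairs -mulnn -sum_nat_const; apply: leq_sum => x _.
by rewrite subset_leq_card // subsetIr.
Qed.

Lemma independent_npairs0 (B : {set T}) : {in B &, forall u v, ~~ e u v} ->
  npairs B B = 0%N.
Proof.
move=> iB; apply: big1 => x xB; apply/eqP; rewrite cards_eq0; apply/eqP/setP => y.
by rewrite !inE; apply/negP => /andP[exy yB]; move: (iB _ _ xB yB); rewrite exy.
Qed.

(** A maximizer S of [npairs S S - p |S|^2] cannot gain from the removal of a
    vertex x, which changes the two terms by twice the inner degree of x and by
    p (2 |S| - 1). This replaces the iterated deletion of vertices of low degree. *)
Lemma dense_core (R : realFieldType) (p : R) :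
  exists S : {set T},
    (npairs setT setT)%:R - p * #|T|%:R ^+ 2
      <= (npairs S S)%:R - p * #|S|%:R ^+ 2 /\
    {in S, forall x, p * (#|S|%:R - 2^-1) <= #|nbhd x :&: S|%:R}.
Proof.
pose g (S : {set T}) : R := (npairs S S)%:R - p * #|S|%:R ^+ 2.
have [S _ Smax] := @arg_maxP _ _ _ setT predT g isT.
exists S; split; first by have := Smax setT isT; rewrite /g cardsT.
move=> x xS; have := Smax (S :\ x) isT.
rewrite /g (npairs_del xS) (cardsD1 x S) xS natrD natrM natrD /=.
by set d := #|nbhd x :&: S|%:R; set m := #|_|%:R; set V := (npairs _ _)%:R; nra.
Qed.

(** Turan's bound with its error term. Let x be a vertex of maximal degree in S,
    V1 the set of non-neighbours of x in S and S1 the set of its neighbours. The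
    edges that meet V1 number at most |V1| |S1|, since every vertex of V1 has degree
    at most |S1|; continue inside S1. The classes found in q steps partition
    S \ B, and the Cauchy-Schwarz inequality for their sizes gives the term
    (|S| - |B|)^2. The clique may stop short of q vertices only when nothing is
    left, in which case the inequality still holds. *)
Lemma greedy_clique (R : realFieldType) (q : nat) (S : {set T}) :
  exists Q : {set T}, let B := S :&: common_nbhd Q in
    [/\ Q \subset S, clique Q, (#|Q| == q) || (B == set0)
      & q%:R * ((npairs S S)%:R - (npairs B B)%:R)
          + (#|S|%:R - #|B|%:R) ^+ 2
        <= q%:R * (#|S|%:R ^+ 2 - #|B|%:R ^+ 2) :> R].
Proof.
have cl0 : clique set0 by move=> u v; rewrite inE.
have com0 : common_nbhd set0 = setT.
  by apply/setP => v; rewrite [RHS]inE; apply/common_nbhdP => u; rewrite inE.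
elim: q S => [|q IH] S.
  exists set0; rewrite com0 setIT; split=> //; rewrite ?sub0set ?cards0 //.
  by rewrite !subrr expr0n /= !mul0r addr0.
have [->|/set0Pn[x0 x0S]] := eqVneq S set0.
  exists set0; rewrite set0I; split=> //; rewrite ?eqxx ?orbT ?cards0 //.
  by rewrite !subrr expr0n /=; lra.
have [x xS xmax] := @arg_maxnP _ x0 (fun x => x \in S) (fun x => #|nbhd x :&: S|) x0S.
pose S1 := S :&: nbhd x; have S1S : S1 \subset S := subsetIl _ _.
have [Q []] := IH S1; set B := S1 :&: _ => QS1 cQ QB ineq.
have xQ : x \notin Q.
  by apply/negP => /(subsetP QS1); rewrite !inE e_irr andbF.
exists (x |: Q).
have -> : S :&: common_nbhd (x |: Q) = B.
  apply/setP => v; rewrite /B /S1 -setIA inE [in RHS]inE; congr andb.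
  apply/common_nbhdP/setIP => [h|[xv /common_nbhdP Qv] u].
    split; first by rewrite inE h ?setU11.
    by apply/common_nbhdP => u uQ; rewrite h // inE uQ orbT.
  by move=> /setU1P[->|/Qv] //; rewrite inE in xv.
split.
- by rewrite subUset sub1set xS (subset_trans QS1).
- apply: cliqueU1 => //; apply/common_nbhdP => u /(subsetP QS1).
  by rewrite !inE e_sym => /andP[].
- by rewrite cardsU1 xQ.
have sz : #|S| = (#|S :\: S1| + #|S1|)%N.
  by rewrite -(cardsID S1 S) (setIidPr S1S) addnC.
have volS : (npairs S S <= npairs S1 S1 + 2 * (#|S :\: S1| * #|S1|))%N.
  have le : (npairs (S :\: S1) S <= #|S :\: S1| * #|S1|)%N.
    rewrite -sum_nat_const; apply: leq_sum => v /setDP[vS _].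
    by rewrite /S1 (setIC S (nbhd x)); apply: xmax.
  rewrite (npairs_split S1S) (npairsDr (S :\: S1) S1S) in le *; lia.
have BS : (#|B| <= #|S1|)%N by rewrite subset_leq_card ?subsetIl.
move: volS; rewrite -(ler_nat R) natrD !natrM sz natrD.
move: ineq; set V := (npairs S S)%:R; set V1 := (npairs S1 S1)%:R.
set VB := (npairs B B)%:R; set b := #|B|%:R; set s := #|S1|%:R; set v := #|_|%:R.
case: q {IH QB} => [|q] ineq volS.
  have w0 : s - b = 0.
    by apply/eqP; rewrite -sqrf_eq0 eq_le sqr_ge0; lra.
  have -> : v + s - b = v by lra.
  have : V1 = VB.
    have/eqP := w0; rewrite subr_eq0 eqr_nat => /eqP sb.
    suff BE : B = S1 by rewrite /VB BE.
    by apply/eqP; rewrite eqEcard subsetIl /= sb.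
  nra.
have q0 : 0 < q.+1%:R :> R by rewrite ltr0n.
rewrite -(natr1 q.+1); set t := q.+1%:R in q0 ineq *.
have t1 : 0 <= t + 1 by lra.
have h1 := ler_wpM2l (mulr_ge0 (ltW q0) t1) volS.
have h2 := ler_wpM2l t1 ineq.
have h3 := sqr_ge0 (s - b - t * v).
(* The square is the defect in (v + w)^2 <= (t + 1) (v^2 + w^2 / t), w = s - b. *)
by rewrite -(ler_pM2l q0); lra.
Qed.

End Density.

(** * Cliques and common neighbourhoods in a core of large minimum degree *)

Section Core.
Variables (T : finType) (e : rel T).
Hypotheses (e_sym : symmetric e) (e_irr : irreflexive e).
Notation nbhd := (nbhd e).
Notation common_nbhd := (common_nbhd e).
Notation clique := (clique e).
Variables (r : nat).
Hypothesis (crit : edge_critical e r.+2).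

(** The set C of the vertices of S adjacent to all of K but x is independent by the
    codegree argument for K \ x. A neighbour of u in C that lies outside K is
    not adjacent to x, because K has a vertex adjacent to neither end of that
    edge, and u leaves no choice but x. Hence the neighbours of u lie outside C
    and, but for K, among the non-neighbours of x, a set that contains C. *)
Lemma card_near_apex (S K : {set T}) x : K \subset S -> clique K ->
    #|K| = r.+2 -> x \in K ->
  let C := S :&: common_nbhd (K :\ x) in
  (#|C| <= 2)%N \/
  exists2 u, u \in S &
    (#|C| + #|nbhd x :&: S| + #|nbhd u :&: S| <= #|S| + r.+2)%N.
Proof.
move=> KS cK Kr xK C; case: (leqP #|C| 2) => C3; [by left | right].
have KxE := cardsD1 x K; rewrite xK Kr in KxE.
have /set0Pn[y yK] : K :\ x != set0 by rewrite -card_gt0; lia.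
set A := common_nbhd (K :\ x) in C C3 *.
have yQ : y \notin K :\ x :\ y by rewrite setD11.
have cQ : clique (K :\ x :\ y).
  by apply: clique_sub cK; rewrite !subDset !setUA subsetUr.
have Qr : #|K :\ x :\ y| = r by have := cardsD1 y (K :\ x); rewrite yK; lia.
have A3 : (2 < #|A|)%N.
  by apply: leq_trans C3 _; rewrite subset_leq_card ?subsetIr.
have indA : {in A &, forall u v, ~~ e u v}.
  have := codegree_independent e_sym e_irr crit cQ Qr yQ; rewrite setD1K //.
  by apply.
have xA : x \in A.
  by apply/common_nbhdP => u /setD1P[ux uK]; apply: cK.
have /set0Pn[u /setD1P[ux uC]] : C :\ x != set0.
  by rewrite -card_gt0; have := cardsD1 x C; case: (x \in C); lia.
have [uS uA] := setIP uC.
have uK : u \notin K.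
  apply: contraL uA => uK; apply: (notin_common_nbhd e_irr).
  by rewrite in_setD1 ux.
exists u => //.
have CS : C \subset S :\: nbhd x.
  apply/subsetP => v /setIP[vS vA]; rewrite inE vS andbT in_nbhd.
  exact: indA.
have sub : nbhd u :&: S \subset ((S :\: nbhd x) :\: C) :|: K.
  apply/subsetP => z /setIP[]; rewrite in_nbhd => euz zS.
  rewrite inE; case: (boolP (z \in K)) => zK; rewrite ?orbT // orbF.
  have [v vK /andP[nvu nvz]] :=
    clique_nonadjacent_edge e_sym e_irr crit cK Kr euz uK zK.
  have vx : v = x.
    apply/eqP/negPn/negP => vx; move/negP: nvu; apply.
    by move/common_nbhdP: uA; apply; rewrite in_setD1 vx.
  rewrite in_setD [z \in S :\: _]in_setD zS in_nbhd -vx nvz !andbT.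
  apply/negP => /setIP[_ zA]; by move: euz; rewrite (negPf (indA _ _ uA zA)).
have := subset_leq_card sub; have := leq_card_setU ((S :\: nbhd x) :\: C) K.
have := cardsD (S :\: nbhd x) C; rewrite (setIidPr CS) Kr.
have := subset_leq_card CS; have := cardsID (nbhd x) S; rewrite setIC.
move=> h1 h2 h3 [h4 _] h5; move: h1 h2 h3 h4 h5; clear.
by move: #|_| #|_| #|_| #|_| #|_| #|_| #|_| => *; lia.
Qed.

(** Every vertex v of S either misses two vertices of K or is counted in C x for
    some x in K; summing over v bounds the degree sum of K. *)
Lemma clique_degree_bound (R : realFieldType) (d M : R) (S K : {set T}) :
    K \subset S -> clique K -> #|K| = r.+2 ->
    {in S, forall x, d <= #|nbhd x :&: S|%:R} ->
    2 <= M -> #|S|%:R - 2 * d + r.+2%:R <= M ->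
  r.+2%:R * d <= r%:R * #|S|%:R + r.+2%:R * M.
Proof.
move=> KS cK Kr mind M2 MS; pose C x := S :&: common_nbhd (K :\ x).
have CM x : x \in K -> #|C x|%:R <= M.
  move=> xK; have [C2|[u uS]] := card_near_apex KS cK Kr xK.
    by apply: le_trans M2; rewrite ler_nat.
  rewrite -(ler_nat R) !natrD -/(C x).
  by have := mind u uS; have := mind x (subsetP KS x xK); lra.
have count v : v \in S ->
  (#|nbhd v :&: K| + 1 <= r.+1 + \sum_(x in K) (v \in C x))%N.
  move=> vS; have nvE := cardsID (nbhd v) K; rewrite setIC Kr in nvE.
  case: (leqP 2 #|K :\: nbhd v|) => h; first by lia.
  have vC x : x \in K -> K :\: nbhd v \subset [set x] -> v \in C x.
    move=> xK sx; rewrite inE vS; apply/common_nbhdP => u /setD1P[ux uK].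
    apply/negPn/negP => nuv; have : u \in K :\: nbhd v.
      by rewrite !inE uK andbT e_sym.
    by move/(subsetP sx); rewrite inE (negPf ux).
  have [h0|/set0Pn[x xD]] := eqVneq (K :\: nbhd v) set0.
    have -> : (\sum_(x in K) (v \in C x) = #|K|)%N.
      rewrite -sum1_card; apply: eq_bigr => x xK.
      by rewrite vC // h0 sub0set.
    by rewrite Kr; lia.
  have DE : K :\: nbhd v = [set x].
    by apply/esym/eqP; rewrite eqEcard sub1set xD cards1; lia.
  have xK : x \in K by case/setDP: xD.
  have := cards1 x; rewrite -DE => D1.
  by rewrite (bigD1 x) //= vC // ?DE //; lia.
have total : (\sum_(x in K) #|nbhd x :&: S| + #|S|
               <= r.+1 * #|S| + \sum_(x in K) #|C x|)%N.
  have -> : (\sum_(x in K) #|C x| = \sum_(v in S) \sum_(x in K) (v \in C x))%N.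
    rewrite exchange_big; apply: eq_bigr => x _ /=.
    rewrite -sum1_card big_mkcond [RHS]big_mkcond; apply: eq_bigr => v _ /=.
    by rewrite /C inE; case: (v \in S) => //=; case: (v \in _).
  rewrite -/(npairs e K S) (npairs_sym e_sym) /npairs.
  rewrite -[X in (_ + X)%N]sum1_card -big_split /= mulnC -sum_nat_const.
  by rewrite -big_split; apply: leq_sum => v /count.
have lo : r.+2%:R * d <= \sum_(x in K) #|nbhd x :&: S|%:R.
  rewrite -Kr mulr_natl -sumr_const; apply: ler_sum => x xK.
  by apply: mind; apply: (subsetP KS).
have hi : \sum_(x in K) #|C x|%:R <= r.+2%:R * M.
  by rewrite -Kr mulr_natl -sumr_const; apply: ler_sum => x /CM.
move: total; rewrite -(ler_nat R) !natrD natrM !natr_sum.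
lra.
Qed.

(** Both sides count pairs (y, z) with z in B: each z contributes at least d,
    the vertices y of B nothing, those of Q at most |B| each, and any other y at
    most half of n + 1 - d, by [codegree_bound] applied to Q and y. *)
Lemma common_nbhd_bound (R : realFieldType) (d : R) (S Q : {set T}) :
    Q \subset S -> clique Q -> #|Q| = r ->
    let B := S :&: common_nbhd Q in
    {in B &, forall u v, ~~ e u v} ->
    {in S, forall x, d <= #|nbhd x :&: S|%:R} ->
    3 + d <= #|T|%:R ->
  2 * #|B|%:R * d
    <= 2 * r%:R * #|B|%:R + (#|S|%:R - #|B|%:R) * (#|T|%:R + 1 - d).
Proof.
move=> QS cQ Qr B indB mind nd.
have yM y : y \in S -> y \notin Q ->
    2 * #|nbhd y :&: B|%:R <= #|T|%:R + 1 - d :> R.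
  move=> yS yQ; set a := #|_|.
  case: (leqP a 2) => [|a3].
    by rewrite -(ler_nat R) => ?; lra.
  have BA : nbhd y :&: B \subset common_nbhd (y |: Q).
    apply/subsetP => v /setIP[yv /setIP[_ /common_nbhdP vQ]].
    by apply/common_nbhdP => u /setU1P[->|/vQ] //; rewrite -in_nbhd.
  have A3 := leq_trans a3 (subset_leq_card BA).
  have /card_gt0P[x xyB] : (0 < a)%N by lia.
  have := codegree_bound e_sym e_irr crit cQ Qr yQ A3 (subsetP BA x xyB).
  have xS : x \in S by case/setIP: xyB => _ /setIP[].
  have := mind x xS.
  have := subset_leq_card BA; have := subset_leq_card (subsetIl (nbhd x) S).
  rewrite -/a -!(ler_nat R) !natrD; lra.
have E : \sum_(y in S) #|nbhd y :&: B|%:R = \sum_(z in B) #|nbhd z :&: S|%:R :> R.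
  by rewrite -!natr_sum; congr (_%:R); apply: (npairs_sym e_sym S B).
have lo : #|B|%:R * d <= \sum_(z in B) #|nbhd z :&: S|%:R.
  rewrite mulr_natl -sumr_const; apply: ler_sum => z /setIP[zS _].
  exact: mind.
have hi : \sum_(y in S) 2 * #|nbhd y :&: B|%:R <=
   \sum_(y in S) ((y \in S :\: B)%:R * (#|T|%:R + 1 - d) +
     (y \in Q)%:R * (2 * #|B|%:R)) :> R.
  apply: ler_sum => y yS; rewrite inE yS andbT.
  have aB : #|nbhd y :&: B|%:R <= #|B|%:R :> R.
    by rewrite ler_nat subset_leq_card ?subsetIr.
  case: (boolP (y \in B)) => yB /=.
    have -> : nbhd y :&: B = set0.
      apply/eqP; rewrite -subset0; apply/subsetP => z /setIP[].
      by rewrite in_nbhd => eyz zB; rewrite (negPf (indB _ _ yB zB)) in eyz.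
    by rewrite cards0 mulr0 mul0r add0r mulr_ge0 // mulr_ge0.
  rewrite mul1r; case: (boolP (y \in Q)) => yQ; last by rewrite mul0r addr0 yM.
  by rewrite mul1r; lra.
move: hi; rewrite -mulr_sumr E big_split -!mulr_suml -!natr_sum /=.
have cnt (X : {set T}) : X \subset S -> (\sum_(y in S) (y \in X) = #|X|)%N.
  move=> XS; rewrite -sum1_card big_mkcond [RHS]big_mkcond; apply: eq_bigr => y _.
  by case: (boolP (y \in X)) => [/(subsetP XS) ->|] //; case: ifP.
rewrite !cnt ?subsetDl // Qr.
have : #|S| = (#|B| + #|S :\: B|)%N.
  by rewrite -(cardsID B S) (setIidPr _) ?subsetIl.
move=> /(congr1 (fun t : nat => t%:R : R)); rewrite natrD natr_sum => sz.
have -> : #|S :\: B|%:R = #|S|%:R - #|B|%:R :> R by rewrite sz; lra.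
lra.
Qed.

End Core.

(** * Numerical estimates *)

(** Relative minimum degree of the core for t parts. The gap 1 / (8 (t + 1)) below
    the Turan density must be less than 1 / (6 (t + 1)), so that the core has no
    clique of size t + 1 even for t = 2, yet large enough for the core to miss
    only a fraction of the size of a part. *)
Definition core_deg (R : realFieldType) (t : R) : R := 1 - t^-1 - (8 * (t + 1))^-1.

(** Allowed loss of density: slightly more than the 1 / (18 (t + 1)^2) that is to
    be proved, the difference being spent on lower-order terms. *)
Definition deficit (R : realFieldType) (t : R) : R := (17 * (t + 1) ^+ 2)^-1.

Section Arith.
Variables (R : realFieldType) (t : R).
Notation p := (core_deg t).
Notation g := (deficit t).

Lemma core_degE : 2 <= t -> 8 * t * (t + 1) * p = 8 * t ^+ 2 - t - 8.
Proof.
move=> t2; have t0 : t != 0 by apply: lt0r_neq0; lra.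
have t1 : t + 1 != 0 by apply: lt0r_neq0; lra.
by rewrite /core_deg; field; rewrite t0 t1.
Qed.

Lemma core_deg_ge0 : 2 <= t -> 0 <= p.
Proof.
move=> t2; have t0 : 0 < 8 * t * (t + 1) by rewrite !mulr_gt0 //; lra.
by rewrite -(ler_pM2l t0) (core_degE t2) mulr0; nra.
Qed.

Lemma deficitE : 2 <= t -> 17 * (t + 1) ^+ 2 * g = 1.
Proof. by move=> t2; rewrite /deficit mulfV //; apply: lt0r_neq0; nra. Qed.

Lemma excessE : 2 <= t -> 136 * (t + 1) ^+ 2 * (1 - t^-1 - g - p) = 17 * t + 9.
Proof.
move=> t2; have t0 : t != 0 by apply: lt0r_neq0; lra.
have t1 : t + 1 != 0 by apply: lt0r_neq0; lra.
by rewrite /core_deg /deficit; field; rewrite t0 t1.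
Qed.

(** In this part n is the number of vertices of the graph and v its number of
    ordered adjacent pairs; m and v' are the same quantities for the core, and b
    is the size of the common neighbourhood B. Here only the trivial bound m^2
    for v' is available, which still makes m large. *)
Lemma core_large (n m v v' : R) : 2 <= t -> 0 <= m -> 2000 * (t + 1) ^+ 3 <= n ->
    (1 - t^-1 - g) * n ^+ 2 < v -> v - p * n ^+ 2 <= v' - p * m ^+ 2 ->
    v' <= m ^+ 2 -> 500 * (t + 1) ^+ 2 <= m.
Proof.
move=> t2 m0 nbig dense core vm; have p0 := core_deg_ge0 t2.
have E := excessE t2; set x := 1 - t^-1 - g in E dense.
have c0 : 0 < 136 * (t + 1) ^+ 2 by rewrite mulr_gt0 // exprn_gt0 //; lra.
have h1 : (x - p) * n ^+ 2 <= m ^+ 2.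
  by have := mulr_ge0 p0 (sqr_ge0 m); lra.
have h2 : (17 * t + 9) * n ^+ 2 <= 136 * (t + 1) ^+ 2 * m ^+ 2.
  by rewrite -E -mulrA ler_pM2l.
have n0 : 0 <= n by apply: le_trans nbig; rewrite mulr_ge0 // exprn_ge0 //; lra.
have h3 : n ^+ 2 <= (4 * (t + 1) * m) ^+ 2.
  have h : 0 <= (2 * t - 2 + 3) * n ^+ 2 by rewrite mulr_ge0 ?sqr_ge0 //; lra.
  by have h' := sqr_ge0 n; nra.
have h4 : n <= 4 * (t + 1) * m.
  by rewrite -(ler_pXn2r (n := 2)) // nnegrE ?mulr_ge0 //; lra.
have t1 : 0 < 4 * (t + 1) by lra.
rewrite -(ler_pM2l t1); apply: le_trans h4; apply: le_trans nbig; lra.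
Qed.

Lemma core_no_clique (m : R) : 2 <= t -> 500 * (t + 1) ^+ 2 <= m ->
  (t - 1) * m + (t + 1) * (m / (4 * (t + 1)) + t + 2) < (t + 1) * (p * (m - 2^-1)).
Proof.
move=> t2 m500; have t0 : 0 < 8 * t by lra.
rewrite -(ltr_pM2l t0).
have -> : 8 * t * ((t + 1) * (p * (m - 2^-1))) = (8 * t ^+ 2 - t - 8) * (m - 2^-1).
  by rewrite -(core_degE t2); ring.
have -> : 8 * t * ((t - 1) * m + (t + 1) * (m / (4 * (t + 1)) + t + 2)) =
    8 * t * (t - 1) * m + 2 * t * m + 8 * t * (t + 1) * (t + 2).
  by field; apply: lt0r_neq0; lra.
pose s := t - 2; have s0 : 0 <= s by rewrite /s; lra.
have -> : t = s + 2 by rewrite /s; lra.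
have m500' : 500 * (s + 3) ^+ 2 <= m by move: m500; rewrite /s; lra.
have h1 : (5 * s + 2) * (500 * (s + 3) ^+ 2) <= (5 * s + 2) * m.
  by rewrite ler_wpM2l //; lra.
have s2 : 0 <= s ^+ 2 by apply: exprn_ge0.
have s3 : 0 <= s ^+ 3 by apply: exprn_ge0.
lra.
Qed.

(** The inequality behind the numerical constants. The coefficients of m on
    the two sides have the same leading term in t; their difference is
    76 t^4 + 237 t^3 - 227 t^2 - 668 t - 288, which is positive for t >= 2. *)
Lemma gap_poly (m : R) : 2 <= t -> 500 * (t + 1) ^+ 2 <= m ->
  8 * t * (t + 1) * ((4 * t ^+ 2 + t - 4) * ((17 * t + 13) * m + (17 * t + 9))
      + 2 * (t - 1) * (3 * t + 4) * (17 * t + 9))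
  < (4 * t ^+ 2 + 7 * t + 4) * (8 * t ^+ 2 - t - 8) * (17 * t + 9) * (m - 2^-1).
Proof.
move=> t2 m500; pose s := t - 2; have s0 : 0 <= s by rewrite /s; lra.
have tE : t = s + 2 by rewrite /s; lra.
(* Expanded around t = 2, all coefficients are nonnegative. *)
have D0 : 0 <= 76 * t ^+ 4 + 237 * t ^+ 3 - 227 * t ^+ 2 - 668 * t - 288.
  have s2 : 0 <= s ^+ 2 by apply: exprn_ge0.
  have s3 : 0 <= s ^+ 3 by apply: exprn_ge0.
  have s4 : 0 <= s ^+ 4 by apply: exprn_ge0.
  by rewrite tE; lra.
have := ler_wpM2l D0 m500; rewrite tE.
have s2 : 0 <= s ^+ 2 by apply: exprn_ge0.
have s3 : 0 <= s ^+ 3 by apply: exprn_ge0.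
have s4 : 0 <= s ^+ 4 by apply: exprn_ge0.
have s5 : 0 <= s ^+ 5 by apply: exprn_ge0.
have s6 : 0 <= s ^+ 6 by apply: exprn_ge0.
by move=> h; lra.
Qed.

(** The Turan bound of the greedy clique reads
    (t b - m)^2 <= t (t - 1) ((1 - 1/t) m^2 - v'), and the lower bound for v'
    compares its right side with n. That it is nonnegative bounds n by m, and its
    size then bounds the deviation of b from m / t. *)
Lemma core_shape (n m b v v' : R) : 2 <= t -> 0 <= m -> m <= n ->
    (1 - t^-1 - g) * n ^+ 2 < v -> v - p * n ^+ 2 <= v' - p * m ^+ 2 ->
    (t - 1) * v' + (m - b) ^+ 2 <= (t - 1) * (m ^+ 2 - b ^+ 2) ->
  (17 * t + 9) * n ^+ 2 <= 17 * (t + 1) * m ^+ 2 /\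
  4 * (t + 1) * (m - t * b) <= t * m.
Proof.
move=> t2 m0 mn dense core turan.
have t0 : 0 < t by lra.
have t1 : 0 < t - 1 by lra.
have q0 : 0 < 136 * (t + 1) ^+ 2 by rewrite mulr_gt0 ?exprn_gt0 //; lra.
have tt1 : 0 < t * (t - 1) by rewrite mulr_gt0.
have E := excessE t2; have PE := core_degE t2.
move: E PE dense core; set x := 1 - t^-1 - g; set p0 := p.
clearbody x p0 => E PE dense core.
have a1 : t * (t - 1) * ((17 * t + 9) * n ^+ 2
      + 17 * (8 * t * (t + 1) * p0) * (t + 1) * m ^+ 2 / t)
    <= t * (t - 1) * (136 * (t + 1) ^+ 2 * v').
  rewrite ler_pM2l // -E -[X in X + _]mulrA.
  have -> : 17 * (8 * t * (t + 1) * p0) * (t + 1) * m ^+ 2 / t =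
      136 * (t + 1) ^+ 2 * (p0 * m ^+ 2) by field; apply: lt0r_neq0.
  rewrite -mulrDr ler_pM2l //; lra.
have a2 : t * (t - 1) * v' + (t * b - m) ^+ 2 <= (t - 1) ^+ 2 * m ^+ 2.
  by have := ler_wpM2l (ltW t0) turan; clear; lra.
have a3 : 136 * (t + 1) ^+ 2 * (t * b - m) ^+ 2 <=
    t * (t - 1) * (17 * (t + 1) * m ^+ 2 - (17 * t + 9) * n ^+ 2).
  move: a1; rewrite PE.
  have -> : t * (t - 1) * ((17 * t + 9) * n ^+ 2 +
       17 * (8 * t ^+ 2 - t - 8) * (t + 1) * m ^+ 2 / t) =
      t * (t - 1) * (17 * t + 9) * n ^+ 2 +
      17 * (t - 1) * (8 * t ^+ 2 - t - 8) * (t + 1) * m ^+ 2.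
    by field; apply: lt0r_neq0.
  by have := ler_wpM2l (ltW q0) a2; clear; lra.
split.
  rewrite -subr_ge0 -(pmulr_rge0 _ tt1).
  by apply: le_trans a3; rewrite mulr_ge0 ?sqr_ge0 ?ltW.
have a4 : t * (t - 1) * (17 * (t + 1) * m ^+ 2 - (17 * t + 9) * n ^+ 2)
    <= t * (t - 1) * (8 * m ^+ 2).
  rewrite ler_pM2l //.
  have nm2 : m ^+ 2 <= n ^+ 2 by rewrite ler_pXn2r // nnegrE ?(le_trans m0).
  by have := ler_wpM2l (_ : 0 <= 17 * t + 9) nm2 => /(_ ltac:(lra)); clear; lra.
have c : 0 <= 4 * (t + 1) by lra.
have [neg|/ltW pos] := lerP (m - t * b) 0.
  by apply: (@le_trans _ _ 0); [exact: mulr_ge0_le0 | exact: mulr_ge0 (ltW t0) m0].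
have nn1 := mulr_ge0 c pos; have nn2 := mulr_ge0 (ltW t0) m0.
rewrite -(ler_pXn2r (n := 2)) ?nnegrE //.
have a5 : 0 <= t * m ^+ 2 by rewrite mulr_ge0 ?sqr_ge0 // ltW.
have a6 : 0 <= t ^+ 2 * m ^+ 2 by rewrite mulr_ge0 ?sqr_ge0.
by move: (le_trans a3 a4) a5 a6; clear; lra.
Qed.

(** Linearizes the comparison of n and m through 2 n m <= n^2 + m^2. *)
Lemma core_order (n m : R) : 2 <= t -> 0 < m ->
    (17 * t + 9) * n ^+ 2 <= 17 * (t + 1) * m ^+ 2 ->
  (17 * t + 9) * n <= (17 * t + 13) * m.
Proof.
move=> t2 m0 nm; rewrite -(ler_pM2l m0).
have c : 0 <= 17 * t + 9 by lra.
by have := mulr_ge0 c (sqr_ge0 (n - m)); move: nm; clear; lra.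
Qed.

(** Contradicts [common_nbhd_bound]. The inequality is monotone in b and in n, so
    that it suffices to check it at the extreme values b = m (3t + 4) / (4t (t + 1))
    and n = m (17t + 13) / (17t + 9). *)
Lemma core_codegree (n m b : R) : 2 <= t -> 500 * (t + 1) ^+ 2 <= m -> m <= n ->
    (17 * t + 9) * n <= (17 * t + 13) * m ->
    4 * (t + 1) * (m - t * b) <= t * m ->
  0 < b /\
  2 * (t - 1) * b + (m - b) * (n + 1 - p * (m - 2^-1))
    < 2 * b * (p * (m - 2^-1)).
Proof.
move=> t2 m500 mn nm bm.
have t0 : 0 < t by lra.
have t1 : 0 < t + 1 by lra.
have q0 : 0 < (t + 1) ^+ 2 by rewrite exprn_gt0.
have m1 : 2 * t <= m.
  apply: le_trans m500; move: (sqr_ge0 t) t0; clear; lra.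
have m0 : 0 < m by lra.
have c : 0 < 4 * t * (t + 1) by rewrite !mulr_gt0.
have bm' : (3 * t + 4) * m <= 4 * t * (t + 1) * b by move: bm; clear; lra.
have b0 : 0 < b.
  rewrite -(pmulr_rgt0 _ c); apply: lt_le_trans bm'; rewrite mulr_gt0 //.
  by move: t0; clear; lra.
split=> //.
have P0 : 0 <= p * (m - 2^-1).
  by rewrite mulr_ge0 ?core_deg_ge0 //; move: m1 t2; clear; lra.
have P8 : 8 * t * (t + 1) * (p * (m - 2^-1)) = (8 * t ^+ 2 - t - 8) * (m - 2^-1).
  by rewrite -(core_degE t2) mulrA.
move: P0 P8; set P := p * _; clearbody P => P0 P8.
have lin : (4 * t ^+ 2 + t - 4) * (n + 1) + 2 * (t - 1) * (3 * t + 4)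
    < (4 * t ^+ 2 + 7 * t + 4) * P.
  have c2 : 0 < 17 * t + 9 by move: t0; clear; lra.
  have c3 : 0 < 8 * t * (t + 1) by move: c; clear; lra.
  rewrite -(ltr_pM2l (mulr_gt0 c3 c2)).
  have -> : 8 * t * (t + 1) * (17 * t + 9) * ((4 * t ^+ 2 + 7 * t + 4) * P) =
    (4 * t ^+ 2 + 7 * t + 4) * (8 * t ^+ 2 - t - 8) * (17 * t + 9) * (m - 2^-1).
    transitivity ((4 * t ^+ 2 + 7 * t + 4) * (17 * t + 9) * (8 * t * (t + 1) * P)).
      by clear; ring.
    by rewrite P8; clear; ring.
  apply: le_lt_trans (gap_poly t2 m500).
  have c4 : 0 <= 4 * t ^+ 2 + t - 4.
    by have := ler_pM2l t0 2 t; rewrite t2; move: t2; clear; lra.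
  by have := ler_wpM2l (mulr_ge0 (ltW c3) c4) nm; clear; lra.
have W0 : 0 <= n + 1 + P - 2 * (t - 1) by move: m1 mn P0; clear; lra.
have a1 := ler_wpM2r W0 bm'.
move: lin; rewrite -(ltr_pM2l m0) => a2.
by rewrite -(ltr_pM2l c); move: a1 a2; clear; lra.
Qed.

End Arith.

(** * The density of an edge-critical graph *)

Theorem edge_critical_density (R : realFieldType) (T : finType) (e : rel T)
    (r : nat) (t : R) : t = r.+1%:R ->
    symmetric e -> irreflexive e -> edge_critical e r.+2 -> (0 < r)%N ->
    2000 * (t + 1) ^+ 3 <= #|T|%:R ->
  (npairs e setT setT)%:R <= (1 - t^-1 - deficit t) * #|T|%:R ^+ 2.
Proof.
move=> tE e_sym e_irr crit r0 nbig; rewrite leNgt; apply/negP => dense.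
have rE : r%:R = t - 1 :> R by rewrite tE -natr1; lra.
have t2 : 2 <= t by rewrite tE (ler_nat R 2).
have [S [coreS degS]] := dense_core e_sym e_irr (core_deg t).
have mn : #|S|%:R <= #|T|%:R :> R by rewrite ler_nat max_card.
have volS : (npairs e S S)%:R <= #|S|%:R ^+ 2 :> R.
  by rewrite -natrX ler_nat npairs_le_sqr.
have m500 := core_large t2 (ler0n _ _) nbig dense coreS volS.
have noK (K : {set T}) : K \subset S -> clique e K -> #|K| = r.+2 -> False.
  move=> KS cK Kr; have := core_no_clique t2 m500; apply/negP; rewrite -leNgt.
  have := clique_degree_bound e_sym e_irr crit KS cK Kr degS.
  rewrite -[r.+2%:R]natr1 -tE rE; apply.
    by have : 0 <= #|S|%:R / (4 * (t + 1)); [apply: divr_ge0 => //; lra | lra].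
  set m := #|S|%:R in m500 *.
  have t0 : 0 < 4 * t * (t + 1) by nra.
  have E : 8 * t * (t + 1) * core_deg t = 8 * t ^+ 2 - t - 8 by apply: core_degE.
  rewrite -(ler_pM2l t0).
  have -> : 4 * t * (t + 1) * (m / (4 * (t + 1)) + t + 2) =
      t * m + 4 * t * (t + 1) * (t + 2) by field; apply: lt0r_neq0; lra.
  have -> : 4 * t * (t + 1) * (m - 2 * (core_deg t * (m - 2^-1)) + (t + 1)) =
      4 * t * (t + 1) * m - (8 * t ^+ 2 - t - 8) * (m - 2^-1)
      + 4 * t * (t + 1) * (t + 1) by rewrite -E; ring.
  have : 0 <= (t - 2) * (t + 1) * m by rewrite !mulr_ge0 //; lra.
  lra.
have indB (Q : {set T}) : Q \subset S -> clique e Q -> #|Q| = r ->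
    {in S :&: common_nbhd e Q &, forall u v, ~~ e u v}.
  move=> QS cQ Qr u v /setIP[uS uQ] /setIP[vS vQ]; apply/negP => euv.
  have vNQ : v \notin Q by apply: contraL vQ; apply: notin_common_nbhd.
  have uvQ : u \in common_nbhd e (v |: Q).
    apply/common_nbhdP => w /setU1P[->|wQ]; first by rewrite e_sym.
    by move/common_nbhdP: uQ; apply.
  have uN : u \notin v |: Q by apply: contraL uvQ; apply: notin_common_nbhd.
  apply: (noK (u |: (v |: Q))).
  - by rewrite !subUset !sub1set uS vS.
  - by apply: cliqueU1 => //; apply: cliqueU1.
  - by rewrite cardsU1 uN cardsU1 vNQ Qr.
have [Q [QS cQ]] := greedy_clique e_sym e_irr R r S.
set B := S :&: _ => QB ineq.
have volB : npairs e B B = 0%N.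
  case/orP: QB => [/eqP Qr|/eqP ->]; last by rewrite /npairs big_set0.
  by apply: independent_npairs0; apply: indB.
rewrite volB subr0 rE in ineq.
have m0 : 0 < #|S|%:R :> R.
  by apply: lt_le_trans m500; rewrite mulr_gt0 ?exprn_gt0 //; lra.
have [nm bm] := core_shape t2 (ltW m0) mn dense coreS ineq.
have [b0] := core_codegree t2 m500 mn (core_order t2 m0 nm) bm.
apply/negP; rewrite -leNgt -rE.
have Qr : #|Q| = r.
  by case/orP: QB => [/eqP|/eqP B0] //; move: b0; rewrite B0 cards0 ltxx.
apply: (common_nbhd_bound e_sym e_irr crit QS cQ Qr (indB Q QS cQ Qr) degS).
have t0 : 0 < 8 * t * (t + 1) by nra.
have E : 8 * t * (t + 1) * core_deg t = 8 * t ^+ 2 - t - 8 by apply: core_degE.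
set m := #|S|%:R in m500 mn *.
suff : 3 + core_deg t * (m - 2^-1) <= m by lra.
rewrite -(ler_pM2l t0).
have -> : 8 * t * (t + 1) * (3 + core_deg t * (m - 2^-1)) =
  24 * t * (t + 1) + (8 * t ^+ 2 - t - 8) * (m - 2^-1) by rewrite -E; ring.
nra.
Qed.

(** * Edge counts of critical graphs and of Turan graphs *)

Section FromSgraph.
Local Open Scope nat_scope.

Lemma edge_card2 (T : finType) (G : sgraph T) E : E \in edges G -> #|E| = 2.
Proof.
by move=> EG; have /forall_inP/(_ E EG)/andP[_ /eqP] := valP G.
Qed.

Lemma adjacent_sym (T : finType) (G : sgraph T) : symmetric (adjacent G).
Proof. by move=> x y; rewrite /adjacent setUC. Qed.

Lemma adjacent_irr (T : finType) (G : sgraph T) : irreflexive (adjacent G).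
Proof.
by move=> x; apply/negP => /edge_card2; rewrite setUid cards1.
Qed.

Lemma handshake (T : finType) (G : sgraph T) :
  npairs (adjacent G) setT setT = 2 * #|edges G|.
Proof.
have -> : 2 * #|edges G| = \sum_(E in edges G) \sum_(x in T) (x \in E).
  rewrite mulnC -sum_nat_const; apply: eq_bigr => E EG.
  rewrite -(edge_card2 EG) -sum1_card big_mkcond /=.
  by apply: eq_bigr => x _; case: (x \in E).
rewrite exchange_big /npairs; apply: eq_big => [x|x _ /=]; first by rewrite !inE.
rewrite setIT.
have -> : \sum_(E in edges G) (x \in E) = #|[set E in edges G | x \in E]|.
  rewrite -sum1_card big_mkcond [RHS]big_mkcond; apply: eq_bigr => E _ /=.
  by rewrite inE; case: (E \in edges G); case: (x \in E).
have inj : {in nbhd (adjacent G) x &, injective (fun y => [set x; y])}.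
  move=> y z; rewrite !in_nbhd => xy xz /setP/(_ y); rewrite !inE eqxx orbT.
  by case/esym/orP => [/eqP yx|/eqP //]; rewrite yx adjacent_irr in xy.
rewrite -(card_in_imset inj); apply: eq_card => E; rewrite inE.
apply/imsetP/andP => [[y]|[EG xE]].
  by rewrite in_nbhd => xy ->; split; rewrite // set21.
have /cards2P[a [b [ab EE]]] : #|E| == 2 by rewrite (edge_card2 EG).
move: xE; rewrite EE => /set2P[->|->].
  by exists b; rewrite // in_nbhd /adjacent -EE.
by exists a; rewrite ?in_nbhd /adjacent setUC // -EE.
Qed.

Lemma colorableP (T : finType) (G : sgraph T) q : vertices G = setT ->
  reflect (exists f : T -> 'I_q, forall x y, adjacent G x y -> f x != f y)
          (colorable q G).
Proof.
move=> VG; have inV x : x \in vertices G by rewrite VG inE.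
apply: (iffP existsP) => [[c /forallP cP]|[f fP]].
  exists (fun x => c (Sub x (inV x))) => x y xy.
  by have /forallP/(_ (Sub y (inV y)))/implyP := cP (Sub x (inV x)); apply.
exists [ffun x => f (val x)]; apply/forallP => x; apply/forallP => y.
by apply/implyP; rewrite !ffunE; apply: fP.
Qed.

Lemma del_edge_simple (T : finType) (G : sgraph T) E :
  simple_graph_axiom (vertices G, edges G :\ E).
Proof.
apply/forall_inP => F /setD1P[_ FG].
by have /forall_inP := valP G; apply.
Qed.

Lemma critical_edge_critical (T : finType) (G : sgraph T) k :
  vertices G = setT -> critical k G -> edge_critical (adjacent G) k.-1.
Proof.
move=> VG /andP[/andP[_ notcol] /forallP crit]; split.
  move=> f; have [|nof] := boolP [exists u, exists v, adjacent G u v && (f u == f v)].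
    by move=> /existsP[u /existsP[v /andP[uv /eqP fuv]]]; exists u, v.
  case/negP: notcol; apply/colorableP => //; exists f => u v uv.
  by move: nof => /existsPn/(_ u)/existsPn/(_ v); rewrite uv.
move=> x y xy; pose H := SGraph (del_edge_simple G [set x; y]).
have HG : proper_subgraph H G.
  rewrite /proper_subgraph subxx subsetDl -(inj_eq val_inj) /=.
  apply/eqP => HE; have := xy; rewrite /adjacent /edges -HE /=.
  by rewrite !inE eqxx.
have /implyP/(_ HG)/(colorableP _ (G := H) VG)[f fP] := crit H.
exists f => u v uv fuv; have [uvE|uvE] := eqVneq [set u; v] [set x; y].
  by rewrite -uvE set21 set22.
have uvH : adjacent H u v by apply/setD1P.
by have := fP u v uvH; rewrite fuv eqxx.
Qed.

(** A residue class modulo r has at most n / r + 1 elements below n. *)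
Lemma turan_npairs r n : 0 < r ->
  n * n <= npairs (adjacent (turan_graph r n)) setT setT + n * (n %/ r).+1.
Proof.
move=> r0; have -> : n * (n %/ r).+1 = \sum_(x in [set: 'I_n]) (n %/ r).+1.
  by rewrite sum_nat_const cardsT card_ord.
have -> : n * n = \sum_(x in [set: 'I_n]) n.
  by rewrite sum_nat_const cardsT card_ord.
rewrite /npairs -big_split; apply: leq_sum => x _ /=; rewrite setIT.
pose D := [set y : 'I_n | y %% r == x %% r].
have Dle : #|D| <= (n %/ r).+1.
  have inj : {in D &, injective (fun y : 'I_n => inord (y %/ r) : 'I_(n %/ r).+1)}.
    move=> y z; rewrite !inE => /eqP yx /eqP zx /(congr1 val) /=.
    have bd (u : 'I_n) : u %/ r < (n %/ r).+1 by rewrite ltnS leq_div2r // ltnW.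
    rewrite !inordK // => yz; apply: val_inj => /=.
    by rewrite (divn_eq y r) (divn_eq z r) yz yx zx.
  by rewrite -(card_in_imset inj) -[X in _ <= X]card_ord max_card.
have DC : ~: D \subset nbhd (adjacent (turan_graph r n)) x.
  apply/subsetP => y; rewrite !inE => xy; apply/imsetP; exists (x, y) => //.
  by rewrite inE /= eq_sym.
rewrite -[X in X <= _](card_ord n) -(cardsC D) addnC.
by rewrite leq_add // subset_leq_card.
Qed.
End FromSgraph.

Unset Implicit Arguments.

Theorem theorem1p1 (R : realType) (k : nat) (hk : (4 <= k)%N) :
  exists c : R,
    1 / (36 * (k%:R - 1) ^+ 2) <= c /\
    exists N : nat, forall n : nat, (N <= n)%N ->
      (max_critical_edges k n)%:R <=
        #|edges (turan_graph (k - 2) n)|%:R - c * n%:R ^+ 2.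
Proof.
exists (1 / (36 * (k%:R - 1) ^+ 2)); split=> //.
exists (2000 * k ^ 3)%N => n nN.
have [r kE] : exists r, k = r.+3 by exists (k - 3)%N; lia.
have r0 : (0 < r)%N by lia.
pose t : R := r.+1%:R.
have t2 : 2 <= t by rewrite /t (ler_nat R 2).
have -> : k%:R - 1 = t + 1 :> R by rewrite kE /t -!natr1; lra.
have -> : (k - 2 = r.+1)%N by lia.
have nbig : 2000 * (t + 1) ^+ 3 <= n%:R.
  rewrite /t natr1 -natrX -natrM ler_nat; apply: leq_trans nN; lia.
have turan : (1 - t^-1) * n%:R ^+ 2 - n%:R
    <= 2 * #|edges (turan_graph r.+1 n)|%:R :> R.
  have := @turan_npairs r.+1 n isT; rewrite handshake -(ler_nat R).
  rewrite natrD !natrM -[(_ %/ _).+1%:R]natr1 => h.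
  have : (n %/ r.+1)%:R <= n%:R / t.
    by rewrite ler_pdivlMr ?ltr0n // -natrM ler_nat leq_divM.
  move=> /(ler_wpM2l (ler0n R n)); clearbody t; lra.
have density (G : sgraph 'I_n) : #|vertices G| = n -> critical k G ->
    2 * #|edges G|%:R <= (1 - t^-1 - deficit t) * n%:R ^+ 2.
  move=> VG crit; have VT : vertices G = setT.
    by apply/eqP; rewrite eqEcard subsetT cardsT card_ord VG /=.
  have := critical_edge_critical VT crit; rewrite kE /= => ec.
  have := edge_critical_density (erefl t) (@adjacent_sym _ G)
            (@adjacent_irr _ G) ec r0.
  by rewrite card_ord handshake natrM; apply.
clearbody t.
have t1 : 0 < t + 1 by lra.
have q0 : 0 < (t + 1) ^+ 2 by rewrite exprn_gt0.
have step (x : R) : 2 * x <= (1 - t^-1 - deficit t) * n%:R ^+ 2 ->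
  x <= #|edges (turan_graph r.+1 n)|%:R - 1 / (36 * (t + 1) ^+ 2) * n%:R ^+ 2.
  have -> : 1 / (36 * (t + 1) ^+ 2) = 17 / 36 * deficit t.
    by rewrite /deficit; field; apply: lt0r_neq0.
  have n18 : 18 <= deficit t * n%:R.
    rewrite -(ler_pM2l (_ : 0 < 17 * (t + 1) ^+ 2)); last by lra.
    rewrite [leRHS]mulrA (deficitE t2) mul1r; apply: le_trans nbig.
    have : (t + 1) ^+ 2 * 3 <= (t + 1) ^+ 2 * (t + 1) by rewrite ler_pM2l //; lra.
    lra.
  have := ler_wpM2r (ler0n R n) n18; lra.
(* The maximum over an empty family is 0, which also satisfies the bound. *)
rewrite /max_critical_edges; elim/big_ind: _.
- apply: step; rewrite mulr0 mulr_ge0 ?sqr_ge0 //.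
  have p0 := core_deg_ge0 t2.
  have q136 : 0 < 136 * (t + 1) ^+ 2 by lra.
  have : 0 <= 1 - t^-1 - deficit t - core_deg t.
    by rewrite -(pmulr_rge0 _ q136) (excessE t2); lra.
  lra.
- by move=> x y hx hy; rewrite /maxn; case: ifP.
by move=> G /andP[/eqP VG crit]; apply/step/density.
Qed.
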